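(* Let $\mathcal{A}$ be a triangular line arrangement in $\mathbb{P}^2=\mathbb{P}^2_{\mathbb{C}}$ (with respect to three non-aligned points $A,B,C$) containing the three side lines $(AB),(AC),(BC)$. Then there exists a Roots-of-Unity-Arrangement $\mathcal{B}$ in $\mathbb{P}^2$ with the same combinatorics as $\mathcal{A}$.
   Context: A line arrangement in $\mathbb{P}^2$ (over $\mathbb{C}$) is a finite set of distinct lines. Given three non-aligned points $A,B,C$, a line arrangement is called triangular if each of its lines passes through $A$, $B$ or $C$. The lines $(AB),(AC),(BC)$ are called the side lines. A triangular arrangement of $a+b+c$ lines defined by an equation $$xyz\prod_{i=1}^{a-1}(x-\alpha_i y)\prod_{j=1}^{b-1}(y-\beta_j z)\prod_{k=1}^{c-1}(x-\gamma_k z)=0$$ is called a Roots-of-Unity-Arrangement (RUA) if the coefficients $\alpha_i,\beta_j,\gamma_k$ can all be expressed as powers of a fixed $n$-th root of unity $\zeta$ (for some positive integer $n$). For a line arrangement $\mathcal{A}$, let $L(\mathcal{A})$ be the set of all intersections of lines of $\mathcal{A}$, partially ordered by reverse inclusion; it is called the combinatorics of $\mathcal{A}$. Two arrangements $\mathcal{A}_0,\mathcal{A}_1$ have the same combinatorics if and only if there is a bijection between $L(\mathcal{A}_0)$ and $L(\mathcal{A}_1)$ preserving the partial order. *)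

(* Defs.v *)
From HB Require Import structures.
From mathcomp Require Import all_boot all_order all_algebra finmap.
From mathcomp Require Import reals complex.

Set Implicit Arguments.
Unset Strict Implicit.
Unset Printing Implicit Defensive.

Import GRing.Theory.
Local Open Scope ring_scope.
Local Open Scope fset_scope.

(* The projective plane over F is modelled by the linear subspaces of F^3:
   points are the subspaces of dimension 1, lines those of dimension 2, and
   the zero subspace is the empty projective set.  Two vspaces are equal iff
   they contain the same vectors. *)
Definition plane_space (F : fieldType) := {vspace 'rV[F]_3}.

Definition is_point (F : fieldType) (p : plane_space F) : Prop := \dim p = 1%N.
Definition is_line (F : fieldType) (l : plane_space F) : Prop := \dim l = 2%N.

Definition non_aligned (F : fieldType) (A B C : plane_space F) : Prop :=
  ~ exists l : plane_space F,
      is_line l /\ [/\ (A <= l)%VS, (B <= l)%VS & (C <= l)%VS].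

Definition line_arrangement (F : fieldType) (Ar : {fset plane_space F}) : Prop :=
  forall l, l \in Ar -> is_line l.

Definition triangular (F : fieldType) (A B C : plane_space F)
    (Ar : {fset plane_space F}) : Prop :=
  line_arrangement Ar /\
  forall l, l \in Ar -> [\/ (A <= l)%VS, (B <= l)%VS | (C <= l)%VS].

(* (A + B)%VS is the line joining two distinct points A and B. *)
Definition contains_side_lines (F : fieldType) (A B C : plane_space F)
    (Ar : {fset plane_space F}) : Prop :=
  [/\ (A + B)%VS \in Ar, (A + C)%VS \in Ar & (B + C)%VS \in Ar].

Definition intersection (F : fieldType) (S : {fset plane_space F}) :
    plane_space F := (\bigcap_(l <- S) l)%VS.

(* The empty subfamily contributes the whole plane. *)
Definition combinatorics (F : fieldType) (Ar : {fset plane_space F}) :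
    {fset plane_space F} :=
  [fset intersection S | S in fpowerset Ar].

Definition Lle (F : fieldType) (Ar : {fset plane_space F})
    (U V : combinatorics Ar) : bool := (val V <= val U)%VS.

Definition same_combinatorics (F : fieldType)
    (Ar0 Ar1 : {fset plane_space F}) : Prop :=
  exists f : combinatorics Ar0 -> combinatorics Ar1,
    bijective f /\ forall U V, Lle (f U) (f V) = Lle U V.

(* The left-hand side of the defining equation, at the vector v = (x, y, z). *)
Definition triangular_eqn (F : fieldType) (a b c : nat)
    (alpha : 'I_a.-1 -> F) (beta : 'I_b.-1 -> F) (gamma : 'I_c.-1 -> F)
    (v : 'rV[F]_3) : F :=
  let x := v 0 (@Ordinal 3 0 isT) in
  let y := v 0 (@Ordinal 3 1 isT) in
  let z := v 0 (@Ordinal 3 2 isT) in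
  x * y * z * \prod_(i < a.-1) (x - alpha i * y)
            * \prod_(j < b.-1) (y - beta j * z)
            * \prod_(k < c.-1) (x - gamma k * z).

(* The cardinality condition makes the a + b + c linear factors pairwise
   non-proportional. *)
Definition roots_of_unity_arrangement (F : fieldType)
    (Ar : {fset plane_space F}) : Prop :=
  line_arrangement Ar /\
  exists (a b c : nat)
    (alpha : 'I_a.-1 -> F) (beta : 'I_b.-1 -> F) (gamma : 'I_c.-1 -> F),
    [/\ [/\ (0 < a)%N, (0 < b)%N & (0 < c)%N],
        #|` Ar| = (a + b + c)%N,
        forall v : 'rV[F]_3, v != 0 ->
          (exists2 l, l \in Ar & v \in l) <->
          triangular_eqn alpha beta gamma v = 0 &
        exists (n : nat) (zeta : F),
          [/\ (0 < n)%N, zeta ^+ n = 1,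
              forall i, exists m : nat, alpha i = zeta ^+ m,
              forall j, exists m : nat, beta j = zeta ^+ m &
              forall k, exists m : nat, gamma k = zeta ^+ m]].

(* Main.v *)
Require Import Defs.
From HB Require Import structures.
From mathcomp Require Import all_boot all_order all_algebra finmap.
From mathcomp Require Import reals complex boolp zify cyclic separable cyclotomic.

(* In coordinates where A, B, C are the vertices of the standard triangle, every
   line of the arrangement is x = a y, y = b z or z = c x for some parameter a,
   b or c, the side lines being those with parameter 0.  Since any two lines
   meet in a point, the combinatorics is determined by the concurrent triples,
   and these only depend on which parameters are equal, which vanish, and
   which satisfy a b c = 1.  The nonzero parameters generate a finitely
   generated abelian group; Smith normal form turns the multiplicative
   relations among them into h_i ^ d_i = 1 for suitable new generators h_i, and
   replacing each generator of infinite order by a sufficiently generic root of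
   unity keeps all the relations without creating any of the finitely many
   forbidden ones. *)

Set Implicit Arguments.
Unset Strict Implicit.
Unset Printing Implicit Defensive.

Import Order.TTheory GRing.Theory Num.Theory.
Local Open Scope fset_scope.
Local Open Scope ring_scope.

(** * Replacing numbers by roots of unity *)

Section Multiplicative.

Variable F : numClosedFieldType.

(** In characteristic 0 the polynomial ['X^n - 1] is separable, so over a closed field it has [n]
    distinct roots, and [n] distinct [n]-th roots of unity include a primitive one. *)
Lemma prim_root_exists n : (0 < n)%N -> exists z : F, n.-primitive_root z.
Proof.
move=> n_gt0; have [r Dp] := closed_field_poly_normal ('X^n - 1 : {poly F}).
rewrite (monicP _) ?monicXnsubC // scale1r in Dp.
have rn1: all n.-unity_root r by apply/allP=> z; rewrite -root_prod_XsubC -Dp.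
have sz_r: (n < (size r).+1)%N by rewrite -(size_prod_XsubC r id) -Dp size_XnsubC.
have [|z] := hasP (has_prim_root n_gt0 rn1 _ sz_r); last by exists z.
by rewrite -separable_prod_XsubC -Dp separable_Xn_sub_1 // pnatr_eq0 -lt0n.
Qed.

(** The powers of a primitive root of order [(size Q).+1] are distinct and outnumber the roots of
    [Q]. *)
Lemma root_of_unity_avoiding (Q : {poly F}) :
  Q != 0 -> exists w n, [/\ (0 < n)%N, w ^+ n = 1 & ~~ root Q w].
Proof.
move=> Q0; have [z pz] := prim_root_exists (ltn0Sn (size Q)).
set rs := [seq z ^+ i | i <- iota 0 (size Q).+1].
have urs : uniq rs.
  rewrite map_inj_in_uniq ?iota_uniq // => i j.
  rewrite !mem_iota /= !add0n => li lj /eqP.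
  by rewrite (eq_prim_root_expr pz) !modn_small // => /eqP.
have /allPn[w /mapP[i _ ->] nw] : ~~ all (root Q) rs.
  apply/negP => /(max_poly_roots Q0) /(_ urs).
  by rewrite size_map size_iota ltnNge leqnSn.
exists (z ^+ i), (size Q).+1; split=> //.
by rewrite exprAC (prim_expr_order pz) expr1n.
Qed.

(** The Laurent monomial with exponent vector [e], evaluated at [g]. For nonzero [g] it is a
    homomorphism in [e], whose kernel is the lattice of multiplicative relations among the [g i]. *)
Definition gpow n (g : 'I_n -> F) (e : 'rV[int]_n) : F := \prod_i g i ^ e 0 i.

Lemma gpow_neq0 n (g : 'I_n -> F) e : (forall i, g i != 0) -> gpow g e != 0.
Proof. by move=> g0; apply/prodf_neq0 => i _; rewrite expfz_neq0. Qed.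

Lemma gpowD n (g : 'I_n -> F) e f :
  (forall i, g i != 0) -> gpow g (e + f) = gpow g e * gpow g f.
Proof.
by move=> g0; rewrite -big_split; apply: eq_bigr => i _; rewrite mxE expfzDr.
Qed.

Lemma gpowN n (g : 'I_n -> F) e :
  gpow g (- e) = (gpow g e)^-1.
Proof. by rewrite -prodfV; apply: eq_bigr => i _; rewrite mxE invr_expz. Qed.

Lemma gpow_delta n (g : 'I_n -> F) i : gpow g (delta_mx 0 i) = g i.
Proof.
rewrite /gpow (bigD1 i) //= mxE !eqxx expr1z big1 ?mulr1 // => j ji.
by rewrite mxE (negPf ji) andbF expr0z.
Qed.

(** Change of generators: the rows of [M] are the exponent vectors of new generators in terms of the
    old ones. *)
Lemma gpow_mulmx m n (g : 'I_n -> F) (e : 'rV[int]_m) (M : 'M[int]_(m, n)) :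
  (forall i, g i != 0) ->
  gpow g (e *m M) = gpow (fun k => gpow g (row k M)) e.
Proof.
move=> g0; rewrite /gpow.
under [RHS]eq_bigr => k _.
  rewrite (big_morph (fun x : F => x ^ e 0 k) (id1 := 1) (op1 := *%R)); last first.
  - exact: exp1rz.
  - by move=> x y; rewrite expfzMl.
  over.
rewrite exchange_big; apply: eq_bigr => j _; rewrite mxE.
rewrite (big_morph (fun z : int => g j ^ z) (id1 := 1) (op1 := *%R)); last first.
- by rewrite expr0z.
- by move=> x y; rewrite expfzDr.
by apply: eq_bigr => k _; rewrite mxE exprz_exp mulrC.
Qed.

Definition is_unity_root (x : F) := exists2 n, (0 < n)%N & x ^+ n = 1.

Lemma unity_root_neq0 x : is_unity_root x -> x != 0.
Proof.
case=> n n0 xn; apply/eqP => x0; move: xn; rewrite x0 expr0n.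
by rewrite gtn_eqF //= => /esym/eqP; rewrite oner_eq0.
Qed.

Lemma unity_root_exprz x (k : int) : is_unity_root x -> is_unity_root (x ^ k).
Proof.
by case=> n n0 xn; exists n => //; rewrite exprnP exprzAC -exprnP xn exp1rz.
Qed.

Lemma unity_root_prod (I : Type) (r : seq I) (G : I -> F) :
  (forall i, is_unity_root (G i)) -> is_unity_root (\prod_(i <- r) G i).
Proof.
move=> uG; apply: (big_ind is_unity_root) => //; first by exists 1%N.
move=> x y [a a0 xa] [b b0 yb]; exists (a * b)%N; first by rewrite muln_gt0 a0.
by rewrite exprMn exprM xa expr1n mulnC exprM yb expr1n mulr1.
Qed.

Lemma unity_root_common (s : seq F) : {in s, forall x, is_unity_root x} ->
  exists2 n, (0 < n)%N & {in s, forall x, x ^+ n = 1}.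
Proof.
elim: s => [|x s IH] us; first by exists 1%N.
have [|n n0 ns] := IH; first by move=> y ys; apply: us; rewrite inE ys orbT.
have [|m m0 xm] := us x; first by rewrite mem_head.
exists (m * n)%N; first by rewrite muln_gt0 m0.
move=> y; rewrite inE => /orP[/eqP->|/ns yn].
  by rewrite exprM xm expr1n.
by rewrite mulnC exprM yn expr1n.
Qed.

(** Each forbidden equation [c i * w ^ k i = 1] makes [w] a root of a nonzero polynomial, so it is
    enough to avoid the roots of the product of these polynomials. *)
Lemma unity_root_generic (I : eqType) (s : seq I) (c : I -> F) (k : I -> int) :
  (forall i, c i != 0) ->
  exists2 w, is_unity_root w & {in s, forall i, k i != 0 -> c i * w ^ k i != 1}.
Proof.
move=> c0.
(* A negative exponent is cleared by inverting the equation. The value 1 for a zero exponent keeps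
   the product nonzero. *)
pose q i : {poly F} := if k i == 0 then 1 else
  if 0 <= k i then 'X^(`|k i|%N) - (c i)^-1%:P else 'X^(`|k i|%N) - (c i)%:P.
have qN0 i : q i != 0.
  rewrite /q; have [_|ki] := eqVneq (k i) 0; first by rewrite oner_eq0.
  by case: ifP => _; rewrite -size_poly_gt0 size_XnsubC // absz_gt0.
have [|w [n [n0 wn nr]]] := @root_of_unity_avoiding (\prod_(i <- s) q i).
  by rewrite prodf_seq_neq0; apply/allP => i _; rewrite qN0.
exists w; first by exists n.
move=> i iS ki; apply: contra nr => /eqP ck.
have w0 : w != 0 by apply: unity_root_neq0; exists n.
rewrite /root horner_prod prodf_seq_eq0; apply/hasP; exists i => //=.
rewrite /q (negPf ki); case: ifP => [k0|/negbT]; rewrite ?hornerE ?hornerXn.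
  rewrite subr_eq0; apply/eqP; apply: (mulfI (c0 i)).
  by rewrite mulfV // exprnP gez0_abs.
rewrite -ltNge => k0; rewrite subr_eq0; apply/eqP.
rewrite exprnP ltz0_abs //; apply: (mulIf (expfz_neq0 (k i) w0)).
by rewrite ck -expfzDr // addNr expr0z.
Qed.

Definition upd n (g : 'I_n -> F) i w j := if j == i then w else g j.

Lemma gpow_upd n (g : 'I_n -> F) i w e :
  gpow (upd g i w) e = (\prod_(j | j != i) g j ^ e 0 j) * w ^ e 0 i.
Proof.
rewrite /gpow (bigD1 i) //= /upd eqxx mulrC; congr (_ * _).
by apply: eq_bigr => j /negPf->.
Qed.

Lemma unity_roots_generic n (h : 'I_n -> F) (E : seq 'rV[int]_n) :
  (forall i, h i != 0) ->
  exists h' : 'I_n -> F,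
    [/\ forall i, is_unity_root (h' i),
        forall i, is_unity_root (h i) -> h' i = h i &
        {in E, forall e, gpow h e != 1 -> gpow h' e != 1}].
Proof.
move=> h0.
(* Coordinates are replaced one at a time: those in the list are already roots of unity, the others
   are merely nonzero. *)
suff [h' [h'0 uh' keep E']] : exists h' : 'I_n -> F,
    [/\ forall i, h' i != 0, {in enum 'I_n, forall i, is_unity_root (h' i)},
        forall i, is_unity_root (h i) -> h' i = h i &
        {in E, forall e, gpow h e != 1 -> gpow h' e != 1}].
  by exists h'; split=> // i; apply: uh'; rewrite mem_enum.
elim: (enum _) => [|i s [h' [h'0 uh' keep E']]]; first by exists h; split.
have [[k k0 hk]|hi] := lem (is_unity_root (h i)).
  exists h'; split=> // j; rewrite inE => /orP[/eqP->|/uh'//].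
  by rewrite keep; exists k.
(* [c e] is the part of the monomial free of the [i]-th generator, so the new monomial is
   [c e * w ^ e 0 i]. *)
pose c e := \prod_(j | j != i) h' j ^ (e : 'rV[int]_n) 0 j.
have [|w uw wE] := unity_root_generic E (c := c) (fun e => e 0 i).
  by move=> e; apply/prodf_neq0 => j _; rewrite expfz_neq0.
exists (upd h' i w); split.
- by move=> j; rewrite /upd; case: (j =P i) => // _; exact: unity_root_neq0.
- move=> j; rewrite inE /upd; case: eqP => //= _; exact: uh'.
- by move=> j uj; rewrite /upd; case: eqP => [ji|_]; [rewrite ji in uj|exact: keep].
move=> e eE /(E' e eE) He; rewrite gpow_upd.
have [ei|] := eqVneq (e 0 i) 0; last exact: wE.
move: He; rewrite /gpow (bigD1 i) //= ei !expr0z mul1r.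
by rewrite mulr1.
Qed.

(** In the basis given by the Smith normal form, the relations holding in [E] read [h_i ^ d_i = 1].
    Generators with [d_i] nonzero are roots of unity and stay fixed; a generic choice of the others
    creates no new relation in [E]. *)
Lemma unity_root_model n (g : 'I_n -> F) (E : seq 'rV[int]_n) :
  (forall i, g i != 0) ->
  exists2 g' : 'I_n -> F, forall i, is_unity_root (g' i) &
    {in E, forall e, (gpow g' e == 1) = (gpow g e == 1)}.
Proof.
move=> g0; pose E1 := [seq e <- E | gpow g e == 1].
pose M : 'M[int]_(size E1, n) := \matrix_i nth 0 E1 i.
have gM i : gpow g (row i M) = 1.
  rewrite rowK; have := mem_nth 0 (ltn_ord i).
  by rewrite mem_filter => /andP[/eqP].
have [L uL [P uP [d _ DM]]] := int_Smith_normal_form M.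
set D := (X in L *m X *m P) in DM.
pose h k := gpow g (row k P).
have h0 k : h k != 0 by exact: gpow_neq0.
have hg e : gpow h (e *m invmx P) = gpow g e.
  by rewrite -[e in RHS](mulmxKV uP) [RHS]gpow_mulmx.
have [h' [uh' keep hE]] := unity_roots_generic [seq e *m invmx P | e <- E] h0.
have h'0 k : h' k != 0 by exact: unity_root_neq0.
have hD i : gpow h (row i D) = 1.
  have -> : row i D = row i (invmx L) *m M *m invmx P.
    by rewrite DM !mulmxA mulmxK // -!row_mul mulVmx // mul1mx.
  rewrite hg gpow_mulmx // /gpow big1 // => k _.
  by rewrite -/(gpow g _) gM exp1rz.
have h'D i : gpow h' (row i D) = 1.
  rewrite -[RHS](hD i); apply: eq_bigr => j _; rewrite !mxE.
  have [ij|] := eqVneq (i : nat) j; last by rewrite mulr0n !expr0z.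
  rewrite mulr1n; have [->|di] := eqVneq d`_i 0; first by rewrite !expr0z.
  (* The row of [D] has the single entry [d_i], so [h j] has finite order and was left unchanged. *)
  rewrite keep //; exists (absz d`_i); first by rewrite absz_gt0.
  have := hD i; rewrite /gpow (bigD1 j) //= big1 => [|k kj]; last first.
    by move: kj; rewrite !mxE ij -val_eqE eq_sym => /= /negPf->; rewrite mulr0n expr0z.
  rewrite mulr1 !mxE ij eqxx mulr1n -ij.
  case: (ltrP d`_i 0) => dlt.
    by move=> /(congr1 GRing.inv); rewrite invr1 invr_expz -ltz0_abs // exprnP.
  by rewrite exprnP gez0_abs.
exists (fun k => gpow h' (row k (invmx P))).
  by move=> i; apply: unity_root_prod => j; apply: unity_root_exprz.
move=> e eE; rewrite -gpow_mulmx // -(hg e).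
apply/idP/idP => [|/eqP he]; first by apply: contraLR; apply: hE; apply: map_f.
have /(nthP 0)[i iE1 ei] : e \in E1 by rewrite mem_filter -hg he eqxx.
have -> : e = row (Ordinal iE1) M by rewrite rowK.
rewrite -row_mul DM mulmxK // row_mul gpow_mulmx // /gpow big1 // => k _.
by rewrite -/(gpow h' _) h'D exp1rz.
Qed.

(* [chi] restricts to [X] a homomorphism from the group generated by [X] to the
   roots of unity which kills neither the nontrivial quotients [x / y] nor the
   nontrivial products [x * y * z]. *)
Lemma unity_root_character (X : seq F) : 0 \notin X ->
  exists chi : F -> F, exists n,
    [/\ (0 < n)%N, chi 0 = 0, {in X, forall x, chi x ^+ n = 1},
        {in X &, injective chi} &
        {in X & &, forall x y z, (chi x * chi y * chi z == 1) = (x * y * z == 1)}].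
Proof.
move=> X0; set m := size X; pose g (i : 'I_m) := X`_i.
have g0 i : g i != 0.
  by apply: contraNneq X0 => <-; rewrite mem_nth.
pose e (i : 'I_m) : 'rV[int]_m := delta_mx 0 i.
(* [E1] encodes the quotients of two elements and [E2] the products of three. *)
pose E1 := [seq e p.1 - e p.2 | p <- enum {: 'I_m * 'I_m}].
pose E2 := [seq e p.1.1 + e p.1.2 + e p.2 | p <- enum {: 'I_m * 'I_m * 'I_m}].
have [g' ug' gE] := unity_root_model (E1 ++ E2) g0.
have g'0 i : g' i != 0 by exact: unity_root_neq0.
have gI i j : g' i = g' j -> g i = g j.
  have : e i - e j \in E1 ++ E2.
    rewrite mem_cat; apply/orP; left.
    by apply/mapP; exists (i, j); rewrite ?mem_enum.
  move=> /gE; rewrite !gpowD // !gpowN !gpow_delta => H eij.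
  move: H; rewrite eij divff // eqxx => /esym/eqP H.
  by rewrite -[RHS]mul1r -H mulfVK.
have gM i j k : (g' i * g' j * g' k == 1) = (g i * g j * g k == 1).
  have : e i + e j + e k \in E1 ++ E2.
    rewrite mem_cat; apply/orP; right.
    by apply/mapP; exists (i, j, k); rewrite ?mem_enum.
  by move=> /gE; rewrite !gpowD // !gpow_delta.
(* The default 0 outside [X] yields [chi 0 = 0], because 0 is not in [X]. *)
pose chi x := if insub (index x X) is Some i then g' i else 0.
have chiP x : x \in X -> exists2 i, chi x = g' i & x = g i.
  move=> xX; have lt : (index x X < m)%N by rewrite index_mem.
  by exists (Ordinal lt); rewrite /chi ?insubT // /g nth_index.
have [|n n0 ns] := @unity_root_common [seq chi x | x <- X].
  by move=> _ /mapP[x /chiP[i -> _] ->].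
exists chi, n; split=> //.
- rewrite /chi insubF // ltnNge; apply/negbF; move: X0.
  by rewrite -index_mem -leqNgt.
- by move=> x xX; apply: ns; rewrite map_f.
- by move=> x y /chiP[i -> ->] /chiP[j -> ->]; exact: gI.
by move=> x y z /chiP[i -> ->] /chiP[j -> ->] /chiP[k -> ->].
Qed.

End Multiplicative.

(** * Combinatorics from concurrent triples *)

Section Combinatorics.

Variable F : fieldType.

Lemma subv_bigcap_seq (vT : vectType F) (I : Type) (r : seq I) (P : pred I)
    (U : {vspace vT}) (V : I -> {vspace vT}) :
  (U <= \bigcap_(i <- r | P i) V i)%VS = all (fun i => P i ==> (U <= V i)%VS) r.
Proof.
elim: r => [|i r IH]; first by rewrite big_nil subvf.
by rewrite big_cons /=; case: (P i) => //=; rewrite subv_cap IH.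
Qed.

(** * Intersections of an indexed family of lines *)

Section Enumeration.

Variables (T : eqType) (P : seq T) (l : T -> plane_space F).
Hypothesis dim_l : forall p, \dim (l p) = 2%N.

Definition concurrent p q r := (l p :&: l q <= l r)%VS.

Hypothesis l_inj : {in P &, injective l}.

Lemma dim_meet p q : p \in P -> q \in P -> p != q -> (\dim (l p :&: l q) <= 1)%N.
Proof.
move=> pP qP; apply: contraNT; rewrite -ltnNge => d2; apply/eqP/l_inj => //.
have /eqP <- : (l p :&: l q)%VS == l p by rewrite eqEdim capvSl dim_l.
by apply/eqP; rewrite eqEdim capvSr dim_l.
Qed.

(** If [s] contains two distinct lines, then either all of [s] passes through their meet, and the
    intersection is that meet, or some line misses it and the intersection is 0. Otherwise the
    intersection is a single line or the whole space. The right-hand side thus refers to concurrency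
    only. *)
Lemma bigcap_lines_sub s r : {subset s <= P} -> r \in P ->
  (\bigcap_(q <- s) l q <= l r)%VS =
  (r \in s) || has (fun p => has (fun q =>
    (p != q) && (concurrent p q r || has (fun m => ~~ concurrent p q m) s)) s) s.
Proof.
move=> sP rP; set W := (\bigcap_(q <- s) _)%VS.
have Wl p : p \in s -> (W <= l p)%VS.
  by move=> ps; have := subvv W; rewrite {2}/W subv_bigcap_seq => /allP /(_ p ps).
apply/idP/idP => [Wr|/orP[/Wl//|]].
  case: s @W Wl Wr sP => [|p s] W Wl Wr sP.
    (* The empty intersection is the whole space, of dimension 3, and lies in no line. *)
    by have := dimvS Wr; rewrite /W big_nil dimvf dim_l.
  rewrite -implyNb; apply/implyP => nr.
  have [/hasP[q qs pq]|/hasPn same] := boolP (has (fun q => p != q) (p :: s)).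
    apply/hasP; exists p; first by rewrite mem_head.
    apply/hasP; exists q => //; rewrite pq andTb.
    have [|/hasPn conc] := boolP (has _ _); first by rewrite orbT.
    rewrite orbF; apply: subv_trans Wr; rewrite /W subv_bigcap_seq.
    by apply/allP => m /conc /negPn.
  case/negP: nr; suff -> : r = p by rewrite mem_head.
  apply: l_inj => //; first by rewrite sP ?mem_head.
  apply/esym/eqP; rewrite eqEdim !dim_l leqnn andbT.
  apply: subv_trans Wr; rewrite /W subv_bigcap_seq.
  by apply/allP => m /same /negPn /eqP <- /=; exact: subvv.
case/hasP => p ps /hasP[q qs /andP[pq]].
have Wpq : (W <= l p :&: l q)%VS by rewrite subv_cap !Wl.
case/orP => [conc|/hasP[m ms nconc]]; first exact: subv_trans conc.
(* Since [m] does not contain the meet, [W] is strictly smaller than a space of dimension at most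
   1. *)
suff -> : W = 0%VS by exact: sub0v.
apply/eqP; rewrite -dimv_eq0 -leqn0 -ltnS.
rewrite (leq_trans _ (dim_meet (sP _ ps) (sP _ qs) pq)) // ltn_neqAle dimvS // andbT.
apply: contra nconc => /eqP dimW; rewrite /concurrent.
have /eqP <- : W == (l p :&: l q)%VS by rewrite eqEdim Wpq dimW leqnn.
exact: Wl.
Qed.

(** Intersecting further lines that contain [V] does not change [V], so each flat has a canonical
    description: the intersection of all lines containing it. *)
Lemma mem_combinatorics (Ar : {fset plane_space F}) V :
  Ar =i [seq l p | p <- P] ->
  (V \in combinatorics Ar) = (V == \bigcap_(p <- P | (V <= l p)%VS) l p)%VS.
Proof.
move=> ArP; apply/idP/eqP => [/imfsetP[/= S]|VP].
  rewrite fpowersetE => /fsubsetP SA VS.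
  have VlS m : m \in S -> (V <= m)%VS.
    move=> mS; have := subvv V; rewrite {2}VS /intersection subv_bigcap_seq.
    by move=> /allP /(_ m mS).
  apply/eqP; rewrite eqEsubv; apply/andP; split.
    by rewrite subv_bigcap_seq; apply/allP => p _; apply/implyP.
  rewrite [in X in (_ <= X)%VS]VS /intersection subv_bigcap_seq; apply/allP => m mS /=.
  have := SA m mS; rewrite ArP => /mapP[p pP mp].
  set W := (\bigcap_(p <- P | _) _)%VS.
  have := subvv W; rewrite {2}/W subv_bigcap_seq => /allP /(_ p pP) /implyP.
  by rewrite -mp; apply; exact: VlS.
apply/imfsetP; exists [fset m in Ar | (V <= m)%VS] => /=.
  by rewrite fpowersetE; apply/fsubsetP => m; rewrite !inE => /andP[].
apply/eqP; rewrite eqEsubv /intersection; apply/andP; split.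
  rewrite subv_bigcap_seq; apply/allP => m /=.
  by rewrite !inE /= => /andP[].
set W := (\bigcap_(m <- _) _)%VS.
have := subvv W; rewrite {2}/W subv_bigcap_seq => /allP WP.
rewrite VP subv_bigcap_seq; apply/allP => p pP; apply/implyP => Vp.
by apply: (WP (l p)); rewrite !inE /= ArP map_f.
Qed.

End Enumeration.

(** * Transport of flats between two families of lines *)

Section Transport.

Variables (T : eqType) (P : seq T).

Definition transport (l l' : T -> plane_space F) V : plane_space F :=
  (\bigcap_(p <- P | (V <= l p)%VS) l' p)%VS.

(** Both families induce the same closure operator on the index set. *)
Definition same_flats (l l' : T -> plane_space F) :=
  forall s r, {subset s <= P} -> r \in P ->
    (\bigcap_(q <- s) l q <= l r)%VS = (\bigcap_(q <- s) l' q <= l' r)%VS.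

Variables (l l' : T -> plane_space F) (Ar Br : {fset plane_space F}).
Hypothesis flats : same_flats l l'.
Hypothesis ArP : Ar =i [seq l p | p <- P].

(** Both sides compare the intersection of the lines containing [V] with the line [p], so
    [same_flats] applies to that subfamily. *)
Lemma transport_sub V p : V \in combinatorics Ar -> p \in P ->
  (transport l l' V <= l' p)%VS = (V <= l p)%VS.
Proof.
rewrite (mem_combinatorics _ ArP) => /eqP VE pP.
rewrite [in RHS]VE /transport -!(big_filter P) flats // => q.
by rewrite mem_filter => /andP[].
Qed.

Lemma transportK V :
  V \in combinatorics Ar -> transport l' l (transport l l' V) = V.
Proof.
move=> VA; have VE := VA; rewrite (mem_combinatorics _ ArP) in VE.
rewrite [RHS](eqP VE) {1}/transport -(big_filter P) -[in RHS](big_filter P).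
congr (\big[_/_]_(i <- _) _); apply: eq_in_filter => p pP.
by rewrite transport_sub.
Qed.

Lemma transport_in V : Br =i [seq l' p | p <- P] ->
  V \in combinatorics Ar -> transport l l' V \in combinatorics Br.
Proof.
move=> BrP VA; rewrite (mem_combinatorics _ BrP); apply/eqP.
rewrite {1}/transport -(big_filter P) -[in RHS](big_filter P).
congr (\big[_/_]_(i <- _) _); apply: eq_in_filter => p pP.
by rewrite transport_sub.
Qed.

Lemma transport_mono U V : U \in combinatorics Ar -> V \in combinatorics Ar ->
  (transport l l' U <= transport l l' V)%VS = (U <= V)%VS.
Proof.
move=> UA VA; have VE := VA; rewrite (mem_combinatorics _ ArP) in VE.
rewrite [in RHS](eqP VE) {2}/transport !subv_bigcap_seq.
by apply: eq_in_all => p pP; rewrite transport_sub.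
Qed.

End Transport.

(* The flats of a simple rank-three matroid are determined by its collinear
   (here: concurrent) triples. *)
Lemma same_combinatorics_concurrent (T : eqType) (P : seq T)
    (l l' : T -> plane_space F) (Ar Br : {fset plane_space F}) :
  (forall p, \dim (l p) = 2%N) -> (forall p, \dim (l' p) = 2%N) ->
  {in P &, injective l} -> {in P &, injective l'} ->
  Ar =i [seq l p | p <- P] -> Br =i [seq l' p | p <- P] ->
  {in P & &, forall p q r, p != q -> concurrent l p q r = concurrent l' p q r} ->
  same_combinatorics Ar Br.
Proof.
move=> dl dl' il il' ArP BrP conc.
have flats : same_flats P l l'.
  move=> s r sP rP; rewrite !(@bigcap_lines_sub _ P) //; congr (_ || _).
  apply: eq_in_has => p ps; apply: eq_in_has => q qs.
  case: (boolP (p == q)) => //= pq; rewrite conc ?rP ?sP //; congr (_ || _).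
  by apply: eq_in_has => m ms; rewrite conc ?sP.
have flats' : same_flats P l' l by move=> s r sP rP; rewrite flats.
pose f (U : combinatorics Ar) : combinatorics Br :=
  [` transport_in flats ArP BrP (valP U)].
pose g (U : combinatorics Br) : combinatorics Ar :=
  [` transport_in flats' BrP ArP (valP U)].
exists f; split.
  exists g => U; apply: val_inj => /=; first exact: (transportK flats ArP (valP U)).
  exact: (transportK flats' BrP (valP U)).
by move=> U V; apply: (transport_mono flats ArP); apply: valP.
Qed.

End Combinatorics.

(** * Lines through the vertices of a triangle *)

Section TriangularLines.

Variable F : fieldType.

(** The line with dual coordinates [n], that is, with the entries of [n] as coefficients of its
    equation. *)
Definition kernel_line (n : 'cV[F]_3) : plane_space F :=
  lker (linfun (mulmxr n : 'rV[F]_3 -> 'rV[F]_1)).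

Lemma mem_kernel_line n v : (v \in kernel_line n) = (v *m n == 0).
Proof. by rewrite memv_ker lfunE. Qed.

Lemma dim_kernel_line n : n != 0 -> \dim (kernel_line n) = 2%N.
Proof.
move=> n0; have := limg_ker_dim (linfun (mulmxr n : 'rV[F]_3 -> 'rV[F]_1)) fullv.
rewrite capfv -/(kernel_line n) dimvf => H.
set I := (_ @: _)%VS in H.
have I1 : (\dim I <= 1)%N by rewrite (leq_trans (dimvS (subvf I))) // dimvf.
have I0 : (0 < \dim I)%N.
  rewrite lt0n dimv_eq0; apply: contraNneq n0 => I0.
  apply/eqP/row_matrixP => i; rewrite row0 rowE; apply/eqP.
  rewrite -[_ *m n]/(mulmxr n _) -(lfunE (mulmxr n : 'rV[F]_3 -> 'rV[F]_1)).
  by rewrite -memv0 -I0 memv_img // memvf.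
have I1' : \dim I = 1%N by apply/eqP; rewrite eqn_leq I1 I0.
by move: H; rewrite I1' addn1 => -[].
Qed.

(** A basis of [l] gives a matrix of rank at most 2, so its cokernel matrix has a nonzero column,
    which serves as normal vector. *)
Lemma is_line_kernel (l : plane_space F) : is_line l ->
  exists2 n, n != 0 & l = kernel_line n.
Proof.
move=> dl; pose M : 'M[F]_(\dim l, 3) := \matrix_i tnth (vbasis l) i.
have : cokermx M != 0.
  rewrite -mxrank_eq0 mxrank_coker -lt0n subn_gt0.
  by rewrite (leq_ltn_trans (rank_leq_row M)) // dl.
move=> cM; have [j cj] : exists j, col j (cokermx M) != 0.
  apply/existsP; apply: contraNT cM => /existsPn c0.
  apply/eqP/matrixP => i j; have /negPn/eqP := c0 j.
  by move=> /matrixP /(_ i 0); rewrite !mxE.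
exists (col j (cokermx M)) => //; apply/eqP.
rewrite eqEdim dim_kernel_line //; apply/andP; split; last by rewrite dl.
rewrite -{1}(span_basis (vbasisP l)); apply/span_subvP => v /tnthP[i ->].
have -> : tnth (vbasis l) i = row i M by rewrite rowK.
rewrite mem_kernel_line.
by rewrite colE mulmxA -row_mul mulmx_coker row0 mul0mx.
Qed.

(* [(t, a)] encodes the line [x_t = a x_(t+1)], indices taken modulo 3, in the
   coordinates [v *m N]; it passes through the vertex number [t + 2], and the
   side lines are those with [a = 0].  Below, the elements 1 and 2 of ['I_3] are
   written [0 + 1] and [0 + 1 + 1] for the cyclic rewriting rules to apply. *)
Definition tri_normal (p : 'I_3 * F) : 'cV[F]_3 :=
  delta_mx p.1 0 - p.2 *: delta_mx (p.1 + 1) 0.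

Definition tri_line (N : 'M[F]_3) (p : 'I_3 * F) := kernel_line (N *m tri_normal p).

Lemma mulmx_tri_normal (u : 'rV[F]_3) p :
  u *m tri_normal p = (u 0 p.1 - p.2 * u 0 (p.1 + 1))%:M.
Proof.
apply/matrixP => i j; rewrite !ord1 mulmxBr -scalemxAr -!colE !mxE.
by rewrite eqxx mulr1n.
Qed.

Lemma mem_tri_line N p v :
  (v \in tri_line N p) = ((v *m N) 0 p.1 == p.2 * (v *m N) 0 (p.1 + 1)).
Proof.
rewrite mem_kernel_line mulmxA mulmx_tri_normal -[in RHS]subr_eq0.
apply/eqP/eqP => [/matrixP /(_ 0 0)|->]; last by rewrite raddf0.
by rewrite !mxE eqxx mulr1n.
Qed.

Lemma ord3E (t : 'I_3) :
  ((t + 1 + 1 + 1 = t)%R * ((t + 1 == t)%R = false) * ((t + 1 + 1 == t)%R = false) *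
   ((t + 1 + 1 == t + 1)%R = false))%type.
Proof. by case: t => [[|[|[|//]]] ?]; do !split=> //; apply/val_inj. Qed.

Lemma ord3_cases (t s : 'I_3) : [\/ s = t, s = t + 1 | s = t + 1 + 1].
Proof.
case: t => [[|[|[|//]]] ?]; case: s => [[|[|[|//]]] ?];
  (by apply: Or31; apply/val_inj) || (by apply: Or32; apply/val_inj)
  || (by apply: Or33; apply/val_inj).
Qed.

Definition coords (t : 'I_3) (a b c : F) (i : 'I_3) : F :=
  if i == t then a else if i == t + 1 then b else c.

Lemma coordsE t a b c : ((coords t a b c t = a) * (coords t a b c (t + 1)%R = b) *
  (coords t a b c (t + 1 + 1)%R = c))%type.
Proof. by rewrite /coords !ord3E !eqxx. Qed.

Definition on_line (x : 'I_3 -> F) (p : 'I_3 * F) := x p.1 == p.2 * x (p.1 + 1).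

Lemma mem_tri_lineP N p v : (v \in tri_line N p) = on_line ((v *m N) 0) p.
Proof. exact: mem_tri_line. Qed.

Section Coordinates.

Variable N : 'M[F]_3.
Hypothesis uN : N \in unitmx.

Lemma dim_tri_line p : \dim (tri_line N p) = 2%N.
Proof.
apply: dim_kernel_line; apply/eqP => /(congr1 (mulmx (invmx N))).
rewrite mulKmx // mulmx0 => /(congr1 (mulmx (delta_mx 0 p.1 : 'rV[F]_3))).
rewrite mulmx_tri_normal mulmx0 => /matrixP /(_ 0 0).
rewrite !mxE !eqxx ord3E mulr0 subr0 => /eqP.
by rewrite oner_eq0.
Qed.

Lemma vector_coords (x : 'I_3 -> F) : exists v : 'rV[F]_3, (v *m N) 0 =1 x.
Proof. by exists ((\row_i x i) *m invmx N) => i; rewrite mulmxKV // mxE. Qed.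

Lemma eq_on_line x y p : x =1 y -> on_line x p = on_line y p.
Proof. by move=> xy; rewrite /on_line !xy. Qed.

Lemma concurrentP p q r :
  reflect (forall x, on_line x p -> on_line x q -> on_line x r)
          (concurrent (tri_line N) p q r).
Proof.
apply: (iffP subvP) => [H x xp xq|H v].
  have [v vx] := vector_coords x.
  have := H v; rewrite memv_cap !mem_tri_lineP !(eq_on_line _ vx) xp xq.
  exact.
by rewrite memv_cap !mem_tri_lineP => /andP[]; exact: H.
Qed.

Lemma tri_line_inj : injective (tri_line N).
Proof.
move=> [t a] [s b] /eqP pq.
have {}pq x : on_line x (t, a) -> on_line x (s, b).
  have [v vx] := vector_coords x.
  by rewrite -!(eq_on_line _ vx) -!mem_tri_lineP (eqP pq).
(* These two points span the line [(t, a)]; the second is its vertex. *)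
have := pq (coords t a 1 0); have := pq (coords t 0 0 1).
rewrite /on_line /=.
case: (ord3_cases t s) => ->; rewrite ?ord3E !coordsE !mulr0 ?mulr1 !eqxx.
- by move=> _ /(_ isT) /eqP ->.
- by move=> _ /(_ isT); rewrite oner_eq0.
- by move=> /(_ isT); rewrite oner_eq0.
Qed.

(** Distinct lines of type [t] meet only in a vertex, and the other lines through it are those of
    type [t] and the side [x_(t+1) = 0]. *)
Lemma concurrent_same t a b r : a != b ->
  concurrent (tri_line N) (t, a) (t, b) r = (r.1 == t) || (r.1 == t + 1) && (r.2 == 0).
Proof.
move=> ab; case: r => s c /=.
have x0 x : on_line x (t, a) -> on_line x (t, b) -> x t = 0 /\ x (t + 1) = 0.
  rewrite /on_line /= => /eqP -> /eqP /eqP; rewrite -subr_eq0 -mulrBl mulf_eq0.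
  by rewrite subr_eq0 (negPf ab) => /= /eqP ->; rewrite mulr0.
apply/concurrentP/idP => [/(_ (coords t 0 0 1))|H x xa xb].
  rewrite /on_line /= !coordsE !mulr0 eqxx => /(_ isT isT).
  case: (ord3_cases t s) => ->; rewrite ?ord3E !coordsE ?mulr0 ?mulr1 ?eqxx //=.
    by rewrite eq_sym.
  by rewrite oner_eq0.
have [xt xt1] := x0 _ xa xb; rewrite /on_line /=.
case/orP: H => [/eqP ->|/andP[/eqP -> /eqP ->]]; first by rewrite xt xt1 mulr0.
by rewrite xt1 mul0r.
Qed.

(** The two lines meet in the point with coordinates [(a * b, b, 1)] at [t], [t + 1], [t + 2]; the
    three cases substitute it into the third equation. *)
Lemma concurrent_next t a b r :
  concurrent (tri_line N) (t, a) (t + 1, b) r =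
  if r.1 == t then (a == r.2) || (b == 0) else
  if r.1 == t + 1 then b == r.2 else a * b * r.2 == 1.
Proof.
case: r => s c /=.
apply/concurrentP/idP => [/(_ (coords t (a * b) b 1))|H x].
  rewrite /on_line /= !coordsE mulr1 !eqxx => /(_ isT isT).
  case: (ord3_cases t s) => ->; rewrite ?ord3E !coordsE ?eqxx ?mulr1 //.
    by rewrite -subr_eq0 -mulrBl mulf_eq0 subr_eq0.
  by move=> /eqP ->; rewrite mulrC.
rewrite /on_line /= => /eqP xt /eqP xt1; rewrite xt1 in xt; move: H.
case: (ord3_cases t s) => ->; rewrite ?ord3E ?eqxx ?xt ?xt1.
- by case/orP => /eqP -> //; rewrite mul0r !mulr0.
- by move=> /eqP ->.
by move=> /eqP H; rewrite !mulrA -[c * a * b]mulrA mulrC [c * _]mulrC H mulr1.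
Qed.

End Coordinates.

Lemma concurrent_sym (T : eqType) (l : T -> plane_space F) p q r :
  concurrent l p q r = concurrent l q p r.
Proof. by rewrite /concurrent capvC. Qed.

(** Two lines have equal or cyclically consecutive types, up to exchanging them. The criteria above
    involve only equality, vanishing and products equal to 1, all respected by [f]. *)
Lemma concurrent_transfer N N' (D : pred F) (f : F -> F) p q r :
  N \in unitmx -> N' \in unitmx ->
  {in D &, injective f} -> {in D, forall x, (f x == 0) = (x == 0)} ->
  {in D & &, forall x y z, (f x * f y * f z == 1) = (x * y * z == 1)} ->
  p.2 \in D -> q.2 \in D -> r.2 \in D -> p != q ->
  concurrent (tri_line N) p q r =
  concurrent (tri_line N') (p.1, f p.2) (q.1, f q.2) (r.1, f r.2).
Proof.
move=> uN uN' finj f0 fM; case: p q r => [t a] [s b] [k c] /= aD bD cD pq.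
have fE := inj_in_eq finj.
case: (ord3_cases t s) pq => -> pq.
- have ab : a != b by apply: contra pq => /eqP ->.
  by rewrite !concurrent_same ?fE //= f0.
- by rewrite !concurrent_next //= !fE // f0 // fM.
rewrite concurrent_sym [RHS]concurrent_sym -{2 4}(ord3E t).1.1.1.
by rewrite !concurrent_next //= !fE // f0 // fM.
Qed.

End TriangularLines.

(** * Coordinates adapted to the triangle *)

Section Coordinates.

Variable F : fieldType.

Lemma point_vline (A : plane_space F) : is_point A -> exists a, A = <[a]>%VS.
Proof.
move=> dA; exists (vpick A); apply/esym/eqP; rewrite eqEdim -memvE memv_pick.
by rewrite dA dim_vline vpick0 -dimv_eq0 dA.
Qed.

(** Passing through vertex [s] kills the coefficient [m s 0]. The remaining equation is solved for
    [x_(s+1)], or reduces to [x_(s+2) = 0] if [x_(s+1)] does not occur. *)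
Lemma line_through_vertex (N : 'M[F]_3) (s : 'I_3) (a : 'rV[F]_3)
    (l : plane_space F) : N \in unitmx -> a *m N = delta_mx 0 s -> is_line l ->
  a \in l -> exists p, l = tri_line N p.
Proof.
move=> uN aN dl al; have [n n0 ln] := is_line_kernel dl.
pose m := invmx N *m n.
have mE v : (v \in l) = (v *m N *m m == 0).
  by rewrite ln mem_kernel_line mulmxA mulmxK.
have ms : m s 0 = 0.
  by move: al; rewrite mE aN -rowE => /eqP /matrixP /(_ 0 0); rewrite !mxE.
suff [p lp] : exists p, (l <= tri_line N p)%VS.
  by exists p; apply/eqP; rewrite eqEdim lp dim_tri_line // dl.
have sE v : v \in l ->
    (v *m N) 0 (s + 1) * m (s + 1) 0 = - ((v *m N) 0 (s + 1 + 1) * m (s + 1 + 1) 0).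
  rewrite mE => /eqP /matrixP /(_ 0 0); rewrite mxE [X in _ = X -> _]mxE.
  rewrite (bigD1 s) //= (bigD1 (s + 1)) ?ord3E //= (bigD1 (s + 1 + 1)) ?ord3E //=.
  rewrite ms mulr0 add0r big1 ?addr0 => [/eqP|i /andP[/andP[i1 i2] i3]].
    by rewrite addr_eq0 => /eqP.
  by case: (ord3_cases s i) i1 i2 i3 => ->; rewrite eqxx.
have [m1|m1] := eqVneq (m (s + 1) 0) 0.
  have m2 : m (s + 1 + 1) 0 != 0.
    apply: contra n0 => /eqP m2; have -> : n = N *m m by rewrite mulKVmx.
    suff -> : m = 0 by rewrite mulmx0.
    apply/matrixP => i j; rewrite ord1 [RHS]mxE.
    by case: (ord3_cases s i) => ->.
  exists (s + 1 + 1, 0); apply/subvP => v /sE; rewrite m1 mulr0 mem_tri_line mul0r /=.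
  by move=> /esym/eqP; rewrite oppr_eq0 mulf_eq0 (negPf m2) orbF.
exists (s + 1, - (m (s + 1 + 1) 0 / m (s + 1) 0)); apply/subvP => v /sE H.
rewrite mem_tri_line /=; apply/eqP/(mulIf m1); rewrite H.
by rewrite mulNr mulNr mulrAC divfK // mulrC.
Qed.

Lemma triangle_coordinates (A B C : plane_space F) :
  is_point A -> is_point B -> is_point C -> non_aligned A B C ->
  exists2 N : 'M[F]_3, N \in unitmx &
  [/\ forall l, is_line l -> [\/ (A <= l)%VS, (B <= l)%VS | (C <= l)%VS] ->
        exists p, l = tri_line N p,
      is_line (A + B)%VS -> (A + B)%VS = tri_line N (0 + 1 + 1, 0),
      is_line (A + C)%VS -> (A + C)%VS = tri_line N (0 + 1, 0) &
      is_line (B + C)%VS -> (B + C)%VS = tri_line N (0, 0)].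
Proof.
move=> /point_vline[a ->] /point_vline[b ->] /point_vline[c ->] nal.
pose M : 'M[F]_3 := \matrix_(i < 3) if i == 0 then a else if i == 0 + 1 then b else c.
have Ma : row 0 M = a by rewrite rowK.
have Mb : row (0 + 1) M = b by rewrite rowK ord3E eqxx.
have Mc : row (0 + 1 + 1) M = c by rewrite rowK !ord3E.
(* A null vector of [M] would be the normal of a line through all three points. *)
have uM : M \in unitmx.
  rewrite -unitmx_tr unitmxE unitfE; apply/negP => /det0P[n n0 nM].
  have Mn : M *m n^T = 0 by rewrite -[M]trmxK -trmx_mul nM trmx0.
  have in_l i : row i M \in kernel_line n^T.
    by rewrite mem_kernel_line -row_mul Mn row0.
  apply: nal; exists (kernel_line n^T); split.
    by apply: dim_kernel_line; apply: contra n0 => /eqP n0; rewrite -[n]trmxK n0 trmx0.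
  by split; rewrite -memvE -?Ma -?Mb -?Mc.
have MN i : row i M *m invmx M = delta_mx 0 i by rewrite -row_mul mulmxV // row1.
have aN : a *m invmx M = delta_mx 0 0 by rewrite -Ma MN.
have bN : b *m invmx M = delta_mx 0 (0 + 1) by rewrite -Mb MN.
have cN : c *m invmx M = delta_mx 0 (0 + 1 + 1) by rewrite -Mc MN.
have uN : invmx M \in unitmx by rewrite unitmx_inv.
(* The side joining two vertices is [x_k = 0], with [k] the remaining index. *)
have side (x y : 'rV[F]_3) s t k : x *m invmx M = delta_mx 0 s ->
    y *m invmx M = delta_mx 0 t -> k != s -> k != t ->
    is_line (<[x]> + <[y]>)%VS -> (<[x]> + <[y]>)%VS = tri_line (invmx M) (k, 0).
  move=> xs yt ks kt dl; apply/eqP; rewrite eqEdim dim_tri_line // dl leqnn andbT.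
  rewrite subv_add -!memvE !mem_tri_line xs yt !mul0r !mxE /=.
  by rewrite (negPf ks) (negPf kt) eqxx.
exists (invmx M) => //; split.
- move=> l dl [] vl; rewrite -memvE in vl.
  + exact: line_through_vertex aN dl vl.
  + exact: line_through_vertex bN dl vl.
  + exact: line_through_vertex cN dl vl.
- by apply: side aN bN _ _; rewrite ord3E.
- by apply: side aN cN _ _; rewrite // eq_sym.
by apply: side bN cN _ _.
Qed.

End Coordinates.

Lemma map_preimage (I : Type) (T : eqType) (f : I -> T) (s : seq T) :
  {in s, forall x, exists i, x = f i} -> exists r, s = map f r.
Proof.
elim: s => [|x s IH] H; first by exists [::].
have [|r ->] := IH; first by move=> y ys; apply: H; rewrite inE ys orbT.
by have [|i ->] := H x; [rewrite mem_head|exists (i :: r)].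
Qed.

(** * Construction of the Roots-of-Unity-Arrangement *)

Section RootsOfUnity.

Variable F : numClosedFieldType.

(** The successor in [m] accounts for the side line of each type, matching the [a - 1], [b - 1] and
    [c - 1] factors of the defining equation. *)
Lemma size_by_type (P : seq ('I_3 * F)) : uniq P -> (forall t, (t, 0) \in P) ->
  let m (t : 'I_3) := (size [seq p <- P | (p.1 == t) && (p.2 != 0)]).+1 in
  size P = (m 0%R + m (0 + 1)%R + m (0 + 1 + 1)%R)%N.
Proof.
move=> uP P0 m.
have mE t : m t = count (fun p => p.1 == t) P.
  rewrite -size_filter -(count_predC (pred1 (t, 0))) !count_filter.
  rewrite (@eq_count _ _ (pred1 (t, 0))) => [|[s x]]; last first.
    by rewrite /= !xpair_eqE andbAC andbb.
  rewrite count_uniq_mem // P0 add1n /m size_filter; congr _.+1.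
  apply: eq_count => -[s x] /=; rewrite xpair_eqE.
  by case: (s == t); rewrite ?andbT ?andbF.
rewrite !mE; elim: P {uP P0 m mE} => //= p P ->.
case: (ord3_cases 0 p.1) => ->; rewrite ?ord3E ?eqxx
  ?[0 == _]eq_sym ?[_ == 0 + 1 + 1]eq_sym ?ord3E; lia.
Qed.

Lemma roots_of_unity_triangular (P : seq ('I_3 * F)) (chi : F -> F) n :
  uniq P -> (forall t, (t, 0) \in P) -> (0 < n)%N -> chi 0 = 0 ->
  {in P, forall p, p.2 != 0 -> chi p.2 ^+ n = 1} ->
  {in P &, injective (fun p => (p.1, chi p.2))} ->
  roots_of_unity_arrangement
    [fset tri_line 1%:M (p.1, chi p.2) | p in P].
Proof.
move=> uP P0 n0 chi0 chin chi_inj; split.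
  by move=> _ /imfsetP[/= p _ ->]; apply: dim_tri_line; rewrite unitmx1.
pose S t := [seq p <- P | (p.1 == t) && (p.2 != 0)].
pose c t (i : 'I_(size (S t)).+1.-1) := chi (nth (t, 0) (S t) i).2.
have SP t (i : 'I_(size (S t))) : nth (t, 0) (S t) i \in S t by rewrite mem_nth.
exists (size (S 0)).+1, (size (S (0 + 1))).+1, (size (S (0 + 1 + 1))).+1.
(* Lines of the third type read [z = c x], whereas the defining equation has [x = gamma z]; hence
   the inverse. *)
exists (@c 0), (@c (0 + 1)), (fun k => (@c (0 + 1 + 1) k)^-1).
have cn t i : @c t i ^+ n = 1.
  have := SP t i; rewrite mem_filter => /andP[/andP[_ p0] pP].
  exact: chin.
have c0 t i : @c t i != 0.
  by apply/eqP => c0; have /eqP := cn t i; rewrite c0 expr0n gtn_eqF // eq_sym oner_eq0.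
split=> //.
- rewrite -size_by_type // -(size_map (fun p => tri_line 1%:M (p.1, chi p.2)) P).
  apply/perm_size/uniq_perm; first exact: fset_uniq.
    rewrite map_inj_in_uniq // => p q pP qP /tri_line_inj; rewrite unitmx1.
    by move=> /(_ isT); exact: chi_inj.
  by move=> l; apply/imfsetP/mapP => /= -[p pP ->]; exists p.
- move=> v _.
  have eqn t : (exists2 p, p \in P & p.1 = t /\ on_line (v 0) (t, chi p.2)) <->
      v 0 t = 0 \/ exists i, v 0 t = @c t i * v 0 (t + 1).
    split=> [[[s x] pP [/= st /eqP /= vt]]|[v0|[i vi]]].
    + subst s; have [x0|x0] := eqVneq x 0; first by left; rewrite vt x0 chi0 mul0r.
      right; have xS : (t, x) \in S t by rewrite mem_filter /= eqxx x0.
      have li : (index (t, x) (S t) < size (S t))%N by rewrite index_mem.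
      by exists (Ordinal li); rewrite /c /= nth_index.
    + by exists (t, 0) => //; split=> //; rewrite /on_line /= v0 chi0 mul0r.
    exists (nth (t, 0) (S t) i); last first.
      have := SP t i; rewrite mem_filter => /andP[/andP[/eqP -> _] _]; split=> //.
      exact/eqP.
    by have := SP t i; rewrite mem_filter => /andP[].
  have e0 : @Ordinal 3 0 isT = 0 by exact: val_inj.
  have e1 : @Ordinal 3 1 isT = 0 + 1 by exact: val_inj.
  have e2 : @Ordinal 3 2 isT = 0 + 1 + 1 by exact: val_inj.
  have prod0 k (G : 'I_k -> F) : (\prod_i G i = 0) <-> exists i, G i = 0.
    split=> [/eqP/prodf_eq0[i _ /eqP]|[i Gi]]; first by exists i.
    by apply/eqP/prodf_eq0; exists i => //; apply/eqP.
  have mul0 (x y : F) : x * y = 0 <-> x = 0 \/ y = 0.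
    by split=> [/eqP|H]; [rewrite mulf_eq0 => /orP[]/eqP; [left|right]|
      apply/eqP; rewrite mulf_eq0; apply/orP; case: H => /eqP; [left|right]].
  have sub0 (x y : F) : x - y = 0 <-> x = y.
    by split=> [/eqP|->]; rewrite ?subrr // subr_eq0 => /eqP.
  have last i x y : x - (@c (0 + 1 + 1) i)^-1 * y = 0 <-> y = @c (0 + 1 + 1) i * x.
    rewrite sub0; split=> ->; first by rewrite mulVKf.
    by rewrite mulKf.
  (* The lines are regrouped by type; each type contributes a coordinate and one of the three
     products. *)
  transitivity (exists t, exists2 p, p \in P & p.1 = t /\ on_line (v 0) (t, chi p.2)).
    split=> [[_ /imfsetP[/= p pP ->]]|[t [p pP [pt vp]]]].
      by rewrite mem_tri_lineP mulmx1 => vp; exists p.1, p.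
    exists (tri_line 1%:M (p.1, chi p.2)).
      by apply/imfsetP; exists p.
    by rewrite mem_tri_lineP mulmx1 pt.
  rewrite /triangular_eqn e0 e1 e2 !mul0 !prod0.
  have := eqn 0; have := eqn (0 + 1); have := eqn (0 + 1 + 1); rewrite ord3E.
  move=> q2 q1 q0; split=> [[t]|].
    case: (ord3_cases 0 t) => ->; rewrite ?q0 ?q1 ?q2 => -[|[i vi]]; try tauto.
    + by do 2 left; right; exists i; apply/sub0.
    + by left; right; exists i; apply/sub0.
    by right; exists i; apply/last.
  case=> [[[[[|]|]|[i /sub0 vi]]|[i /sub0 vi]]|[i /last vi]].
  + by move=> v0; exists 0; apply/q0; left.
  + by move=> v0; exists (0 + 1); apply/q1; left.
  + by move=> v0; exists (0 + 1 + 1); apply/q2; left.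
  + by exists 0; apply/q0; right; exists i.
  + by exists (0 + 1); apply/q1; right; exists i.
  by exists (0 + 1 + 1); apply/q2; right; exists i.
(* All [n]-th roots of unity are powers of one primitive root. *)
have [z pz] := @prim_root_exists F n n0.
have pow x : x ^+ n = 1 -> exists m : nat, x = z ^+ m.
  by move=> /(prim_rootP pz)[i ->]; exists i.
exists n, z; split=> //; first exact: prim_expr_order.
- by move=> i; apply: pow.
- by move=> i; apply: pow.
by move=> i; apply: pow; rewrite exprVn cn invr1.
Qed.

Lemma triangular_same_combinatorics (A B C : plane_space F)
    (Ar : {fset plane_space F}) :
  is_point A -> is_point B -> is_point C -> non_aligned A B C ->
  triangular A B C Ar -> contains_side_lines A B C Ar ->
  exists Br : {fset plane_space F},
    roots_of_unity_arrangement Br /\ same_combinatorics Ar Br.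
Proof.
move=> pA pB pC nal [lAr tri] [sAB sAC sBC].
have [N uN [lines lAB lAC lBC]] := triangle_coordinates pA pB pC nal.
have [P ArP] : exists P, Ar = map (tri_line N) P :> seq _.
  by apply: map_preimage => l lA; apply: lines; [exact: lAr|exact: tri].
have {}ArP' : Ar =i map (tri_line N) P by move=> l; rewrite -ArP.
have uP : uniq P by rewrite -(map_inj_uniq (tri_line_inj uN)) -ArP fset_uniq.
have P0 t : (t, 0) \in P.
  rewrite -(mem_map (tri_line_inj uN)) -ArP'.
  by case: (ord3_cases 0 t) => ->; rewrite -?lAB -?lAC -?lBC //; exact: lAr.
pose X := [seq x <- map snd P | x != 0].
have [|chi [n [n0 chi0 chin chiI chiM]]] := @unity_root_character F X.
  by rewrite mem_filter eqxx.
have chi_neq0 x : x \in X -> chi x != 0.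
  by move=> /chin xn; apply: unity_root_neq0; exists n.
have XE p : p \in P -> p.2 != 0 -> p.2 \in X.
  by move=> pP p0; rewrite mem_filter p0 map_f.
(* The character controls only nonzero parameters. Adding 0, which [chi] fixes, keeps the side
   lines, and a product with a zero factor is never 1 on either side. *)
pose D : pred F := [pred x | (x == 0) || (x \in X)].
have PD p : p \in P -> p.2 \in D.
  by move=> pP; rewrite inE /=; have [//|/(XE p pP)] := eqVneq p.2 0.
have D0 : {in D, forall x, (chi x == 0) = (x == 0)}.
  move=> x; rewrite inE /= => /orP[/eqP ->|xX]; first by rewrite chi0.
  by rewrite (negPf (chi_neq0 x xX)); move: xX; rewrite mem_filter => /andP[/negPf ->].
have DI : {in D &, injective chi}.
  move=> x y xD yD exy; have := D0 x xD; have := D0 y yD; rewrite exy => ->.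
  move: xD yD; rewrite !inE /= => /orP[/eqP ->|xX]; first by rewrite eqxx => _ /eqP.
  move=> /orP[/eqP ->|yX _]; last exact: chiI.
  by rewrite eqxx => /esym/eqP.
have DM : {in D & &, forall x y z, (chi x * chi y * chi z == 1) = (x * y * z == 1)}.
  have z1 : (0 == 1 :> F) = false by rewrite eq_sym oner_eq0.
  move=> x y z; rewrite !inE /= => /orP[/eqP ->|xX]; first by rewrite chi0 !mul0r.
  move=> /orP[/eqP ->|yX]; first by rewrite chi0 !(mulr0, mul0r).
  by move=> /orP[/eqP ->|zX]; [rewrite chi0 !mulr0|exact: chiM].
have chiPI : {in P &, injective (fun p => (p.1, chi p.2))}.
  by move=> [t a] [s b] /PD /= aD /PD /= bD [-> /DI ->].
(* The new arrangement lives in standard coordinates, with each parameter replaced by its image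
   under [chi]. *)
exists [fset tri_line 1%:M (p.1, chi p.2) | p in P]; split.
  apply: roots_of_unity_triangular n0 chi0 _ chiPI => //.
  by move=> p pP p0; apply: chin; exact: XE.
have u1 : 1%:M \in @unitmx F 3 by rewrite unitmx1.
apply: (same_combinatorics_concurrent (P := P) (l := tri_line N)
          (l' := fun p => tri_line 1%:M (p.1, chi p.2))).
- exact: dim_tri_line.
- by move=> p; exact: dim_tri_line.
- by move=> p q _ _; exact: tri_line_inj.
- by move=> p q pP qP /(tri_line_inj u1); exact: chiPI.
- exact: ArP'.
- move=> l; apply/imfsetP/mapP => /= -[p pP ->]; by exists p.
move=> p q r pP qP rP pq.
have := concurrent_transfer uN u1 DI D0 DM (PD p pP) (PD q qP) (PD r rP) pq.
by rewrite /concurrent.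
Qed.

End RootsOfUnity.

Theorem theorem3p2 (R : realType) (A B C : plane_space R[i])
    (Ar : {fset plane_space R[i]}) :
  is_point A -> is_point B -> is_point C -> non_aligned A B C ->
  triangular A B C Ar -> contains_side_lines A B C Ar ->
  exists Br : {fset plane_space R[i]},
    roots_of_unity_arrangement Br /\ same_combinatorics Ar Br.
Proof. exact: triangular_same_combinatorics. Qed.
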